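(* Let $\mathbf{b}\in\mathbb{R}^d$ be constant, let $c:\Omega\to\mathbb{R}$ be bounded and nonnegative with $c_0=\inf_\Omega c$, let $f$ be bounded on $\Omega$ and $g$ continuous on $\partial\Omega$, and let $\epsilon,\sigma,\gamma\ge0$ and $p\in[0,1]$ be constants. If $\epsilon>0$ or $c_0>0$ or $\gamma>0$, then for every mesh $\mathbf{h}$ the finite difference scheme $$\widehat{L}^\epsilon_{\mathbf{h}}[U_\alpha]=f(\mathbf{x}_\alpha)\ \text{ if }\mathbf{x}_\alpha\in\mathcal{T}_{\mathbf{h}}\cap\Omega,\qquad U_\alpha=g(\mathbf{x}_\alpha)\ \text{ if }\mathbf{x}_\alpha\in\mathcal{T}_{\mathbf{h}}\cap\partial\Omega,$$ $$-\delta^2_{x_i,h_i}U_\alpha=0\ \text{ if }\mathbf{x}_\alpha\in\mathcal{S}_{h_i},\ i=1,\dots,d,$$ has a unique solution $U$ (a grid function on $\mathcal{T}_{\mathbf{h}}$ together with the ghost points).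
   Context: Domain and mesh: $\Omega=(a_1,b_1)\times\cdots\times(a_d,b_d)\subset\mathbb{R}^d$. For integers $J_i\ge 3$ set $h_i=(b_i-a_i)/(J_i-1)$, $\mathbf{h}=(h_1,\dots,h_d)$. The grid is $\mathcal{T}_{\mathbf{h}}=\{\mathbf{x}_\alpha\}$ with $\mathbf{x}_\alpha=(a_1+(\alpha_1-1)h_1,\dots,a_d+(\alpha_d-1)h_d)$, $1\le\alpha_i\le J_i$. Let $\mathbf{e}_i$ be the canonical basis vectors. Boundary nodes and ghost points: $\mathcal{S}_{h_i}$ is the set of $\mathbf{x}_\alpha\in\mathcal{T}_{\mathbf{h}}\cap\partial\Omega$ such that $\mathbf{x}_\alpha+h_i\mathbf{e}_i\in\mathcal{T}_{\mathbf{h}}\cap\Omega$ or $\mathbf{x}_\alpha-h_i\mathbf{e}_i\in\mathcal{T}_{\mathbf{h}}\cap\Omega$. For each $\mathbf{x}_\alpha\in\mathcal{S}_{h_i}$ the one of $\mathbf{x}_\alpha\pm h_i\mathbf{e}_i$ lying outside $\overline{\Omega}$ is a ghost point. Difference operators: $\delta_{x_i,h_i}U_\alpha=\frac{U_{\alpha+\mathbf{e}_i}-U_{\alpha-\mathbf{e}_i}}{2h_i}$, $\nabla_{\mathbf{h}}=[\delta_{x_1,h_1},\dots,\delta_{x_d,h_d}]^T$, $\delta^2_{x_i,h_i}U_\alpha=\frac{U_{\alpha+\mathbf{e}_i}-2U_\alpha+U_{\alpha-\mathbf{e}_i}}{h_i^2}$, $\delta^2_{x_i,2h_i}U_\alpha=\frac{U_{\alpha+2\mathbf{e}_i}-2U_\alpha+U_{\alpha-2\mathbf{e}_i}}{4h_i^2}$,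 $\Delta_{\mathbf{h}}=\sum_{i=1}^d\delta^2_{x_i,h_i}$. Numerical moment: $M^p_{\mathbf{h}}U_\alpha=\sum_{i=1}^d h_i^p(\delta^2_{x_i,2h_i}-\delta^2_{x_i,h_i})U_\alpha$. Numerical operator, for $\mathbf{x}_\alpha\in\mathcal{T}_{\mathbf{h}}\cap\Omega$: $$\widehat{L}^\epsilon_{\mathbf{h}}[U_\alpha]=-\sigma\sum_{i=1}^d h_i^2\delta^2_{x_i,h_i}U_\alpha-\epsilon\Delta_{\mathbf{h}}U_\alpha+\mathbf{b}\cdot\nabla_{\mathbf{h}}U_\alpha+c(\mathbf{x}_\alpha)U_\alpha+\gamma M^p_{\mathbf{h}}U_\alpha .$$ *)

(* Defs.v *)
From HB Require Import structures.
From mathcomp Require Import all_boot all_order all_algebra.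
From mathcomp Require Import all_classical all_reals all_analysis.

Set Implicit Arguments.
Unset Strict Implicit.
Unset Printing Implicit Defensive.
Import Order.TTheory GRing.Theory Num.Theory.
Import numFieldNormedType.Exports.

Local Open Scope classical_set_scope.
Local Open Scope ring_scope.

(* A box is given by its two opposite corners a and b; J i is the number of
   grid points in direction i.  Multi-indices are integer row vectors, so that
   grid points and ghost points are indexed uniformly by [node]. *)

Definition box (R : realType) (d : nat) (a b : 'rV[R]_d) : set 'rV[R]_d :=
  [set x | forall i, a 0 i < x 0 i < b 0 i].

Definition boundary (T : topologicalType) (A : set T) : set T :=
  closure A `\` interior A.

Definition ebas (S : pzRingType) (d : nat) (i : 'I_d) : 'rV[S]_d :=
  delta_mx 0 i.

Definition step (R : realType) (d : nat) (a b : 'rV[R]_d) (J : 'I_d -> nat)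
    (i : 'I_d) : R :=
  (b 0 i - a 0 i) / ((J i)%:R - 1).

Definition node (R : realType) (d : nat) (a b : 'rV[R]_d) (J : 'I_d -> nat)
    (al : 'rV[int]_d) : 'rV[R]_d :=
  \row_i (a 0 i + ((al 0 i)%:~R - 1) * step a b J i).

Definition grid (R : realType) (d : nat) (a b : 'rV[R]_d) (J : 'I_d -> nat) :
    set 'rV[R]_d :=
  [set node a b J al | al in
    [set al : 'rV[int]_d | forall i, 1 <= al 0 i <= (J i)%:Z]].

Definition interior_nodes (R : realType) (d : nat) (a b : 'rV[R]_d)
    (J : 'I_d -> nat) : set 'rV[R]_d :=
  grid a b J `&` box a b.

Definition boundary_nodes (R : realType) (d : nat) (a b : 'rV[R]_d)
    (J : 'I_d -> nat) : set 'rV[R]_d :=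
  grid a b J `&` boundary (box a b).

Definition Sbd (R : realType) (d : nat) (a b : 'rV[R]_d) (J : 'I_d -> nat)
    (i : 'I_d) : set 'rV[R]_d :=
  [set x | boundary_nodes a b J x /\
    (interior_nodes a b J (x + step a b J i *: ebas R i) \/
     interior_nodes a b J (x - step a b J i *: ebas R i))].

Definition ghost_points (R : realType) (d : nat) (a b : 'rV[R]_d)
    (J : 'I_d -> nat) : set 'rV[R]_d :=
  [set y | ~ closure (box a b) y /\
    exists i x, Sbd a b J i x /\
      (y = x + step a b J i *: ebas R i \/ y = x - step a b J i *: ebas R i)].

Definition dx (R : realType) (d : nat) (h : 'I_d -> R) (i : 'I_d)
    (U : 'rV[int]_d -> R) (al : 'rV[int]_d) : R :=
  (U (al + ebas int i) - U (al - ebas int i)) / (2 * h i).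

Definition gradh (R : realType) (d : nat) (h : 'I_d -> R)
    (U : 'rV[int]_d -> R) (al : 'rV[int]_d) : 'rV[R]_d :=
  \row_i dx h i U al.

Definition dxx (R : realType) (d : nat) (h : 'I_d -> R) (i : 'I_d)
    (U : 'rV[int]_d -> R) (al : 'rV[int]_d) : R :=
  (U (al + ebas int i) - 2 * U al + U (al - ebas int i)) / h i ^+ 2.

Definition dxx_2h (R : realType) (d : nat) (h : 'I_d -> R) (i : 'I_d)
    (U : 'rV[int]_d -> R) (al : 'rV[int]_d) : R :=
  (U (al + ebas int i *+ 2) - 2 * U al + U (al - ebas int i *+ 2))
    / (4 * h i ^+ 2).

Definition laph (R : realType) (d : nat) (h : 'I_d -> R)
    (U : 'rV[int]_d -> R) (al : 'rV[int]_d) : R :=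
  \sum_i dxx h i U al.

Definition moment (R : realType) (d : nat) (h : 'I_d -> R) (p : R)
    (U : 'rV[int]_d -> R) (al : 'rV[int]_d) : R :=
  \sum_i (h i `^ p) * (dxx_2h h i U al - dxx h i U al).

Definition dot (R : realType) (d : nat) (u v : 'rV[R]_d) : R :=
  \sum_i u 0 i * v 0 i.

Definition Lhat (R : realType) (d : nat) (a b : 'rV[R]_d) (J : 'I_d -> nat)
    (sigma eps gamma p : R) (bv : 'rV[R]_d) (c : 'rV[R]_d -> R)
    (U : 'rV[int]_d -> R) (al : 'rV[int]_d) : R :=
  let h := step a b J in
  - sigma * (\sum_i h i ^+ 2 * dxx h i U al) - eps * laph h U al
  + dot bv (gradh h U al) + c (node a b J al) * U al
  + gamma * moment h p U al.

(* Grid functions are total functions of the multi-index; only their values on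
   the grid and at the ghost points occur in the equations below, and they are
   identified when they agree there. *)
Definition grid_eq (R : realType) (d : nat) (a b : 'rV[R]_d)
    (J : 'I_d -> nat) (U V : 'rV[int]_d -> R) : Prop :=
  forall al, (grid a b J `|` ghost_points a b J) (node a b J al) ->
    U al = V al.

Definition fd_solution (R : realType) (d : nat) (a b : 'rV[R]_d)
    (J : 'I_d -> nat) (sigma eps gamma p : R) (bv : 'rV[R]_d)
    (c f g : 'rV[R]_d -> R) (U : 'rV[int]_d -> R) : Prop :=
  [/\ forall al, interior_nodes a b J (node a b J al) ->
        Lhat a b J sigma eps gamma p bv c U al = f (node a b J al),
      forall al, boundary_nodes a b J (node a b J al) ->
        U al = g (node a b J al) &
      forall i al, Sbd a b J i (node a b J al) ->
        - dxx (step a b J) i U al = 0].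

(* Main.v *)
(* The scheme is a square linear system for the interior values of U: boundary
   values are prescribed and ghost values are odd reflections of interior ones.
   So it suffices that a solution W of the homogeneous problem vanishes.
   Multiply its equation by W and sum over the interior nodes.  Since W and its
   normal second differences vanish on the boundary, summation by parts kills
   the convection term and turns the second-order terms into squares of first
   differences, and the moment, a fourth difference, into squares of second
   differences.  Hence c W^2 and all these squares vanish.  If only gamma > 0,
   one more summation by parts shows that the first differences vanish too. *)

Require Import Defs.
From HB Require Import structures.
From mathcomp Require Import all_boot all_order all_algebra.
From mathcomp Require Import all_classical all_reals all_analysis.
From mathcomp Require Import zify ring lra.

Set Implicit Arguments.
Unset Strict Implicit.
Unset Printing Implicit Defensive.
Import Order.TTheory GRing.Theory Num.Theory.
Import numFieldNormedType.Exports.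

Local Open Scope classical_set_scope.
Local Open Scope ring_scope.

(** * Inner multi-indices, telescoping sums and finite linear systems *)

Definition inner (d : nat) (J : 'I_d -> nat) (al : 'rV[int]_d) : bool :=
  [forall i, 2 <= al 0 i < (J i)%:Z].

(** Coordinates from 0 to [\max_i J i - 1] are enough, since inner ones are strictly below [J i];
    [undup] gives uniqueness without an injectivity argument. *)
Definition inner_seq (d : nat) (J : 'I_d -> nat) : seq 'rV[int]_d :=
  [seq al <- undup [seq \row_i (phi i)%:Z
                   | phi : {ffun 'I_d -> 'I_(\max_i J i)%N}] | inner J al].

Lemma mem_inner_seq (d : nat) (J : 'I_d -> nat) (al : 'rV[int]_d) :
  (al \in inner_seq J) = inner J al.
Proof.
rewrite mem_filter mem_undup andb_idr // => /forallP Jal.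
have ltJ i : (`|al 0%R i| < \max_i J i)%N.
  by apply: leq_trans (@leq_bigmax _ J i); move: (Jal i); lia.
apply/mapP; exists [ffun i => Ordinal (ltJ i)]; first by rewrite mem_enum.
by apply/rowP => i; rewrite mxE ffunE /=; move: (Jal i); lia.
Qed.

Lemma inner_seq_uniq (d : nat) (J : 'I_d -> nat) : uniq (inner_seq J).
Proof. by rewrite filter_uniq ?undup_uniq. Qed.

(** A discrete divergence theorem: on each grid line in direction [i] the sum telescopes to the flux
    at index [J i - 1] minus the flux at index 1, so only the signs at these two ends matter. *)
Lemma inner_telescope_le (R : numDomainType) (d : nat) (J : 'I_d -> nat)
    (i : 'I_d) (G : 'rV[int]_d -> R) :
  (forall al, inner J al -> al 0 i = (J i)%:Z - 1 -> G al <= 0) ->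
  (forall al, inner J al -> al 0 i = 2 -> 0 <= G (al - ebas int i)) ->
  \sum_(al <- inner_seq J) (G al - G (al - ebas int i)) <= 0.
Proof.
move=> Gend Gstart; rewrite sumrB.
rewrite (bigID (fun al : 'rV_d => al 0 i == (J i)%:Z - 1)) /=.
rewrite [X in _ - X](bigID (fun al : 'rV_d => al 0 i == 2)) /=.
(* The shift by [- ebas int i] maps the inner indices off the first layer bijectively onto those off
   the last layer, so all other terms cancel. *)
have -> : \sum_(al <- inner_seq J | al 0 i != 2) G (al - ebas int i) =
          \sum_(al <- inner_seq J | al 0 i != (J i)%:Z - 1) G al.
  rewrite -big_filter -[RHS]big_filter.
  rewrite -(big_map (fun al => al - ebas int i) predT G); apply: perm_big.
  apply: uniq_perm.
  - rewrite (map_inj_uniq (@addIr _ (- ebas int i))).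
    by rewrite (filter_uniq _ (inner_seq_uniq J)).
  - by rewrite (filter_uniq _ (inner_seq_uniq J)).
  move=> al; apply/mapP/idP => [[be]|].
    rewrite mem_filter mem_inner_seq mem_filter mem_inner_seq =>
      /andP[bei /forallP Jbe] ->.
    rewrite !mxE !eqxx /=; apply/andP; split; first by move: bei (Jbe i); lia.
    apply/forallP => j; rewrite !mxE eqxx /=; move: (Jbe j).
    by case: (eqVneq j i) bei => [->|_] /=; lia.
  rewrite mem_filter mem_inner_seq => /andP[ali /forallP Jal].
  exists (al + ebas int i); last by rewrite addrK.
  rewrite mem_filter mem_inner_seq !mxE !eqxx /=; apply/andP; split.
    by move: ali (Jal i); lia.
  apply/forallP => j; rewrite !mxE eqxx /=; move: (Jal j).
  by case: (eqVneq j i) ali => [->|_] /=; lia.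
rewrite opprD addrACA subrr addr0 subr_le0.
apply: (@le_trans _ _ 0); rewrite big_seq_cond.
  by apply: sumr_le0 => al /andP[]; rewrite mem_inner_seq => ? /eqP; exact: Gend.
by apply: sumr_ge0 => al /andP[]; rewrite mem_inner_seq => ? /eqP; exact: Gstart.
Qed.

(** A square matrix with trivial kernel is invertible; the matrix is that of [L] on functions
    supported in [s]. *)
Lemma finite_system_solvable (F : fieldType) (T : eqType) (s : seq T)
    (L : (T -> F) -> T -> F) :
  uniq s ->
  (forall k u v x, x \in s ->
     L (fun y => k * u y + v y) x = k * L u x + L v x) ->
  (forall u, (forall x, x \in s -> L u x = 0) -> forall x, x \in s -> u x = 0) ->
  forall f : T -> F, exists u, forall x, x \in s -> L u x = f x.
Proof.
move=> us Llin Linj f.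
pose x_ (j : 'I_(size s)) := tnth (in_tuple s) j.
have sx j : x_ j \in s by exact: mem_tnth.
have xs x : x \in s -> exists j, x = x_ j.
  by move=> /(tnthP (in_tuple s)).
have x_inj : injective x_ by apply/tuple_uniqP.
(* [phi] turns a vector into a function on [T], extended by zero outside [s]. *)
pose phi (v : 'rV[F]_(size s)) x := \sum_(j | x_ j == x) v 0 j.
have phix v k : phi v (x_ k) = v 0 k.
  by rewrite /phi (big_pred1 k) // => j; rewrite (inj_eq x_inj).
pose A (v : 'rV[F]_(size s)) : 'rV[F]_(size s) := \row_k L (phi v) (x_ k).
have Alin : linear A.
  move=> k u v; apply/rowP => j; rewrite !mxE -Llin //; congr L.
  apply/funext => x; rewrite /phi mulr_sumr -big_split /=.
  by apply: eq_bigr => m _; rewrite !mxE.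
pose Al : {linear 'rV[F]_(size s) -> 'rV[F]_(size s)} :=
  HB.pack A (GRing.isLinear.Build _ _ _ _ A Alin).
have Aunit : lin1_mx Al \in unitmx.
  rewrite -row_free_unit -kermx_eq0; apply/rowV0P => v /sub_kermxP.
  rewrite mul_rV_lin1 => /rowP Av0; apply/rowP => k; rewrite mxE -phix.
  apply: Linj => // x /xs[j ->]; have := Av0 j.
  by rewrite !mxE.
exists (phi ((\row_k f (x_ k)) *m invmx (lin1_mx Al))) => x /xs[k ->].
have /rowP/(_ k) : A ((\row_k f (x_ k)) *m invmx (lin1_mx Al)) = \row_k f (x_ k).
  by rewrite -[A]/(Al : _ -> _) -mul_rV_lin1 mulmxKV.
by rewrite !mxE.
Qed.

(** * Interior, boundary and face nodes in terms of multi-indices *)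

Definition in_grid (d : nat) (J : 'I_d -> nat) (al : 'rV[int]_d) : Prop :=
  forall i, 1 <= al 0 i <= (J i)%:Z.

(** Index form of [Sbd]: the neighbour along [i] must be interior, which forces the other
    coordinates to be strictly inside and excludes edges and corners. *)
Definition on_face (d : nat) (J : 'I_d -> nat) (i : 'I_d) (al : 'rV[int]_d) :
    Prop :=
  (al 0 i = 1 \/ al 0 i = (J i)%:Z) /\
  forall j, j != i -> 2 <= al 0 j < (J j)%:Z.

Lemma inner_in_grid (d : nat) (J : 'I_d -> nat) (al : 'rV[int]_d) :
  inner J al -> in_grid J al.
Proof. by move=> /forallP Jal i; move: (Jal i); lia. Qed.

Lemma on_face_outer (d : nat) (J : 'I_d -> nat) (i : 'I_d) (al : 'rV[int]_d) :
  on_face J i al -> ~~ inner J al.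
Proof. by move=> [ali _]; apply/negP => /forallP/(_ i); lia. Qed.

Lemma on_face_in_grid (d : nat) (J : 'I_d -> nat) (i : 'I_d)
    (al : 'rV[int]_d) :
  (3 <= J i)%N -> on_face J i al -> in_grid J al.
Proof.
move=> Ji [ali alN] j; case: (eqVneq j i) => [->|/alN]; lia.
Qed.

Section Nodes.
Variables (R : realType) (d : nat) (a b : 'rV[R]_d) (J : 'I_d -> nat).
Hypotheses (hab : forall i, a 0 i < b 0 i) (hJ : forall i, (3 <= J i)%N).

Local Notation h := (step a b J).

Lemma step_gt0 i : 0 < h i.
Proof.
rewrite /step divr_gt0 ?subr_gt0 // ltr1n; move: (hJ i); lia.
Qed.

Lemma stepK i : ((J i)%:R - 1) * h i = b 0 i - a 0 i.
Proof.
rewrite /step mulrCA divff ?mulr1 // subr_eq0 pnatr_eq1; move: (hJ i); lia.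
Qed.

Lemma node_inj : injective (node a b J).
Proof.
move=> al be /rowP nab; apply/rowP => i; have := nab i; rewrite !mxE.
move=> /addrI /(mulIf (lt0r_neq0 (step_gt0 i))) /addIr.
by move/eqP; rewrite eqr_int => /eqP.
Qed.

Lemma nodeDebas i al : node a b J (al + ebas int i) =
  node a b J al + h i *: ebas R i.
Proof.
apply/rowP => j; rewrite !mxE eqxx /=.
by case: (eqVneq j i) => [->|_]; rewrite ?rmorphD /= ?rmorph1 ?rmorph0; ring.
Qed.

Lemma nodeBebas i al : node a b J (al - ebas int i) =
  node a b J al - h i *: ebas R i.
Proof. by rewrite -[in RHS](subrK (ebas int i) al) nodeDebas addrK. Qed.

Lemma grid_node al : grid a b J (node a b J al) <-> in_grid J al.
Proof.
split=> [[be Jbe /node_inj <-]|Jal]; first exact: Jbe.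
by exists al.
Qed.

Lemma node_lt i al : (node a b J al 0 i < b 0 i) = (al 0 i < (J i)%:Z).
Proof.
rewrite mxE -ltrBrDl -stepK ltr_pM2r ?step_gt0 // ltrD2r.
by rewrite -[(J i)%:R]/((J i)%:Z%:~R) ltr_int.
Qed.

Lemma node_le i al : (node a b J al 0 i <= b 0 i) = (al 0 i <= (J i)%:Z).
Proof.
rewrite mxE -lerBrDl -stepK ler_pM2r ?step_gt0 // lerD2r.
by rewrite -[(J i)%:R]/((J i)%:Z%:~R) ler_int.
Qed.

Lemma node_gt i al : (a 0 i < node a b J al 0 i) = (1 < al 0 i).
Proof. by rewrite mxE ltrDl pmulr_lgt0 ?step_gt0 // subr_gt0 ltr1z. Qed.

Lemma node_ge i al : (a 0 i <= node a b J al 0 i) = (1 <= al 0 i).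
Proof. by rewrite mxE lerDl pmulr_lge0 ?step_gt0 // subr_ge0 ler1z. Qed.

Lemma box_node al : box a b (node a b J al) <-> inner J al.
Proof.
split=> [bal|/forallP Jal i]; last by rewrite node_gt node_lt; exact: Jal.
by apply/forallP => i; move: (bal i); rewrite node_gt node_lt.
Qed.

Lemma interior_node al : interior_nodes a b J (node a b J al) <-> inner J al.
Proof.
split=> [[_ /box_node]//|Jal]; split; last exact/box_node.
exact/grid_node/inner_in_grid.
Qed.

Lemma open_box : open (box a b).
Proof.
rewrite openE => x xab.
suff : nbhs x (fun y : 'rV[R]_d => forall i, a 0 i < y 0 i < b 0 i) by [].
apply: (@filter_forall _ _ (fun i y => a 0 i < (y : 'rV_d) 0 i < b 0 i)
  _ (nbhs_filter x)) => i.
have /near_in_itvoo ab_x : x 0 i \in `]a 0 i, b 0 i[ by rewrite in_itv /= xab.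
apply: (@filterS _ _ (nbhs_filter x) _ _ _
  (@coord_continuous R 1 d 0 i x _ ab_x)).
by move=> y; rewrite /= in_itv.
Qed.

Lemma closure_box (x : 'rV[R]_d) :
  (forall i, a 0 i <= x 0 i <= b 0 i) -> closure (box a b) x.
Proof.
move=> xab B /nbhs_ballP[e /= e0 xeB].
have y_ i : exists y, a 0 i < y < b 0 i /\ `|x 0 i - y| < e.
  have := hab i; have := xab i; set u := a 0 i; set v := b 0 i; set w := x 0 i.
  move=> /andP[uw wv] uv.
  (* Each coordinate moves into the open interval, rightwards from the left end and leftwards
     otherwise, by half the smaller of [e] and the available room. *)
  have [uw'|uw'] := ltP u w; last first.
    exists (u + Num.min e (v - u) / 2); have -> : w = u by apply/le_anti/andP.
    by rewrite ltr_norml; case: (leP e (v - u)); lra.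
  exists (w - Num.min e (w - u) / 2).
  by rewrite ltr_norml; case: (leP e (w - u)); lra.
have [y yP] := choice y_.
exists (\row_i y i); split; first by move=> i; rewrite mxE; case: (yP i).
by apply: xeB; split=> // i j; rewrite mxE (ord1 i); case: (yP j).
Qed.

Lemma boundary_node al :
  boundary_nodes a b J (node a b J al) <-> in_grid J al /\ ~~ inner J al.
Proof.
have -> : boundary_nodes a b J (node a b J al) <->
    grid a b J (node a b J al) /\ ~ box a b (node a b J al).
  rewrite /boundary_nodes /boundary /=.
  have -> : (box a b)^° = box a b by apply/interior_id/open_box.
  split=> [[? []]//|[gal bal]]; do 2?split => //; apply: closure_box => i.
  by move/grid_node: gal => /(_ i); rewrite node_ge node_le.
by rewrite grid_node box_node; split=> -[? /negP].
Qed.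

(** A neighbour along [i] shares all other coordinates, so these are inner; coordinate [i] is then
    extremal, or [al] itself would be inner. *)
Lemma Sbd_node i al : Sbd a b J i (node a b J al) <-> on_face J i al.
Proof.
rewrite /Sbd /= -nodeDebas -nodeBebas boundary_node !interior_node.
split=> [[[gal /negP ial] nal]|al_face].
  have alN j : j != i -> 2 <= al 0 j < J j.
    move=> ji; case: nal => /forallP/(_ j);
      by rewrite !mxE eqxx (negPf ji) /= ?oppr0 addr0.
  split=> //; have := gal i.
  suff : ~~ (2 <= al 0 i < J i) by lia.
  apply/negP => ali; apply: ial; apply/forallP => j.
  by case: (eqVneq j i) => [->//|/alN].
have [ali alN] := al_face; split.
  split; [exact: on_face_in_grid al_face|exact: on_face_outer al_face].
(* Here [3 <= J i] matters: it makes the indices 2 and [J i - 1], one step in from the faces, inner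
   coordinates. *)
case: ali => ali; [left|right]; apply/forallP => j; rewrite !mxE eqxx /=;
  by case: (eqVneq j i) => [->|/alN] /=; move: (hJ i); lia.
Qed.

End Nodes.

Lemma inner_on_faceD (d : nat) (J : 'I_d -> nat) (i : 'I_d)
    (al : 'rV[int]_d) :
  inner J al -> al 0 i = (J i)%:Z - 1 -> on_face J i (al + ebas int i).
Proof.
move=> /forallP Jal ali; split=> [|j ji]; rewrite !mxE eqxx /=.
  by rewrite eqxx; right; lia.
by rewrite (negPf ji) addr0.
Qed.

Lemma inner_on_faceB (d : nat) (J : 'I_d -> nat) (i : 'I_d)
    (al : 'rV[int]_d) :
  inner J al -> al 0 i = 2 -> on_face J i (al - ebas int i).
Proof.
move=> /forallP Jal ali; split=> [|j ji]; rewrite !mxE eqxx /=.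
  by rewrite eqxx; left; lia.
by rewrite (negPf ji) subr0.
Qed.

(** * Vanishing of grid functions from differences in one direction *)

Definition diff2 (R : pzRingType) (d : nat) (i : 'I_d) (U : 'rV[int]_d -> R)
    (al : 'rV[int]_d) : R :=
  U (al + ebas int i) - 2 * U al + U (al - ebas int i).

Lemma inner_eq0_of_diff (R : pzRingType) (d : nat) (J : 'I_d -> nat) (i : 'I_d)
    (W : 'rV[int]_d -> R) :
  (forall al, on_face J i al -> W al = 0) ->
  (forall al, inner J al -> W al = W (al - ebas int i)) ->
  forall al, inner J al -> W al = 0.
Proof.
(* Induction on the coordinate along [i]: walking back in steps of [- ebas int i] preserves the
   value and ends on the face of index 1. *)
move=> Wface Wdiff al; move En : `|al 0%R i|%N => n.
elim: n al En => [|n IH] al En Jal; have /forallP/(_ i) Jali := Jal.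
  by lia.
rewrite Wdiff //; have [ali|ali] := eqVneq (al 0 i) 2.
  exact/Wface/inner_on_faceB.
apply: IH; first by rewrite !mxE !eqxx /=; lia.
apply/forallP => j; move/forallP/(_ j) : Jal; rewrite !mxE eqxx /=.
by case: (eqVneq j i) ali => [->|_] /=; lia.
Qed.

(** The second difference of [W ^+ 2] along [i] is [2 * (W * diff2 i W)] plus two squared first
    differences, hence nonnegative. Its sum is at most 0 because [W] vanishes at both ends, so the
    first differences vanish. *)
Lemma inner_eq0_of_diff2 (R : realDomainType) (d : nat) (J : 'I_d -> nat)
    (i : 'I_d) (W : 'rV[int]_d -> R) :
  (forall al, on_face J i al -> W al = 0) ->
  (forall al, inner J al -> 0 <= W al * diff2 i W al) ->
  forall al, inner J al -> W al = 0.
Proof.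
move=> Wface W2; apply: (@inner_eq0_of_diff _ _ _ i) => // al Jal.
pose G al := W (al + ebas int i) ^+ 2 - W al ^+ 2.
have GE be : G be - G (be - ebas int i) = 2 * (W be * diff2 i W be) +
    (W (be + ebas int i) - W be) ^+ 2 + (W be - W (be - ebas int i)) ^+ 2.
  by rewrite /G subrK /diff2; ring.
have G0 be : be \in inner_seq J -> 0 <= G be - G (be - ebas int i).
  rewrite mem_inner_seq => /W2 WD.
  by rewrite GE !addr_ge0 ?sqr_ge0 ?(mulr_ge0 _ WD).
have G_le0 : \sum_(be <- inner_seq J) (G be - G (be - ebas int i)) <= 0.
  apply: inner_telescope_le => be Jbe bei.
    rewrite /G (Wface (be + _)) ?expr0n ?sub0r ?oppr_le0 ?sqr_ge0 //.
    exact: inner_on_faceD.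
  rewrite /G subrK (Wface (be - _)) ?expr0n ?subr0 ?sqr_ge0 //.
  exact: inner_on_faceB.
have : \sum_(be <- inner_seq J | be \in inner_seq J)
    (G be - G (be - ebas int i)) == 0 by rewrite eq_le -{1}big_seq G_le0 sumr_ge0.
rewrite psumr_eq0 // => /allP/(_ al); rewrite mem_inner_seq Jal => /(_ isT).
rewrite /= GE paddr_eq0 ?addr_ge0 ?sqr_ge0 ?(mulr_ge0 _ (W2 _ Jal)) //.
by rewrite sqrf_eq0 subr_eq0 => /andP[_ /eqP].
Qed.

(** * Energy identity and the homogeneous scheme *)

Section Scheme.
Variables (R : realType) (d : nat) (a b : 'rV[R]_d) (J : 'I_d -> nat).
Hypotheses (hab : forall i, a 0 i < b 0 i) (hJ : forall i, (3 <= J i)%N).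
Variables (sigma eps gamma p : R) (bv : 'rV[R]_d) (c : 'rV[R]_d -> R).

Local Notation h := (step a b J).
Local Notation L := (Lhat a b J sigma eps gamma p bv c).

Let T i U al := - sigma * (h i ^+ 2 * dxx h i U al) - eps * dxx h i U al
   + bv 0 i * dx h i U al
   + gamma * (h i `^ p * (dxx_2h h i U al - dxx h i U al)).

Lemma LhatE U al : L U al = \sum_i T i U al + c (node a b J al) * U al.
Proof.
rewrite /T !big_split /= sumrN -!mulr_sumr /Lhat /laph /dot /moment.
under [X in _ + X + _ + _]eq_bigr do rewrite mxE.
exact: addrAC.
Qed.

Lemma Lhat_linear k U V al :
  L (fun be => k * U be + V be) al = k * L U al + L V al.
Proof.
rewrite !LhatE [k * (_ + _)]mulrDr mulr_sumr addrACA -big_split /=.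
congr (_ + _); last by ring.
by apply: eq_bigr => i _; rewrite /T /dxx /dx /dxx_2h; ring.
Qed.

(** In [T i], [- k i] multiplies the undivided second difference and [m i] the undivided fourth
    difference. *)
Let k i := sigma + eps / h i ^+ 2.
Let m i := gamma * h i `^ p / (4 * h i ^+ 2).

(* The last terms of the flux [G] and the energy [Q] come from
   [dxx_2h - dxx = (h_i^2 / 4) dxx dxx] and the discrete Green formula. *)
Let G W i al :=
  k i / 2 * (W (al + ebas int i) ^+ 2 - W al ^+ 2)
  - bv 0 i / (2 * h i) * (W al * W (al + ebas int i))
  - m i * (W al * diff2 i W (al + ebas int i)
           - W (al + ebas int i) * diff2 i W al).

Let Q W i al :=
  k i / 2 * ((W (al + ebas int i) - W al) ^+ 2
             + (W al - W (al - ebas int i)) ^+ 2)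
  + m i * diff2 i W al ^+ 2.

(** Diffusion is squared differences minus half the second difference of [W ^+ 2]. Convection is an
    exact difference of products of neighbours, hence pure flux. Green's formula with [diff2 i W]
    treats the fourth difference. *)
Lemma energy_density W i al :
  W al * T i W al = Q W i al - (G W i al - G W i (al - ebas int i)).
Proof.
have h0 : h i != 0 by rewrite lt0r_neq0 ?step_gt0.
rewrite /G /Q /T /k /m /dxx /dx /dxx_2h /diff2 !subrK addrK mulr2n !addrA.
rewrite !opprD !addrA; field.
by rewrite h0.
Qed.

Hypotheses (heps : 0 <= eps) (hsigma : 0 <= sigma) (hgamma : 0 <= gamma).
Hypothesis hc : forall al, inner J al -> 0 <= c (node a b J al).

Lemma homogeneous_eq0 W : (0 < d)%N ->
  [\/ 0 < eps, forall al, inner J al -> 0 < c (node a b J al) | 0 < gamma] ->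
  (forall al, inner J al -> L W al = 0) ->
  (forall al, in_grid J al -> ~~ inner J al -> W al = 0) ->
  (forall i al, on_face J i al -> dxx h i W al = 0) ->
  forall al, inner J al -> W al = 0.
Proof.
move=> d0 hpos LW Wbd W2.
have Wface i al : on_face J i al -> W al = 0.
  by move=> al_face; apply: Wbd; [exact: on_face_in_grid al_face|
                                  exact: on_face_outer al_face].
have Dface i al : on_face J i al -> diff2 i W al = 0.
  move=> /W2 /eqP; rewrite mulf_eq0 invr_eq0 expf_eq0 /=.
  by rewrite (negPf (lt0r_neq0 (step_gt0 hab hJ i))) orbF => /eqP.
have h0 i : 0 < h i := step_gt0 hab hJ i.
have k0 i : 0 <= k i by rewrite addr_ge0 ?divr_ge0 ?sqr_ge0.
have m0 i : 0 <= m i.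
  by apply: divr_ge0; apply: mulr_ge0; rewrite ?powR_ge0 ?sqr_ge0 ?ler0n.
have k20 i : 0 <= k i / 2 by rewrite divr_ge0.
have grad0 i al : 0 <= k i / 2 * ((W (al + ebas int i) - W al) ^+ 2
    + (W al - W (al - ebas int i)) ^+ 2).
  by rewrite mulr_ge0 // addr_ge0 ?sqr_ge0.
have mom0 i al : 0 <= m i * diff2 i W al ^+ 2 by rewrite mulr_ge0 ?sqr_ge0.
have Q0 i al : 0 <= Q W i al by rewrite addr_ge0.
have cW0 al : inner J al -> 0 <= c (node a b J al) * W al ^+ 2.
  by move=> Jal; rewrite mulr_ge0 ?sqr_ge0 ?hc.
pose E al := \sum_i Q W i al + c (node a b J al) * W al ^+ 2.
have E0 al : al \in inner_seq J -> 0 <= E al.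
  by rewrite mem_inner_seq => Jal; rewrite addr_ge0 ?sumr_ge0 ?cW0.
have EG al : al \in inner_seq J ->
    E al = \sum_i (G W i al - G W i (al - ebas int i)).
  rewrite mem_inner_seq => /LW; rewrite LhatE => /(congr1 ( *%R (W al))).
  rewrite mulr0 mulrDr mulr_sumr; under eq_bigr do rewrite energy_density.
  by rewrite sumrB mulrCA -expr2 addrAC => /subr0_eq <-.
(* On the faces [W] and [diff2 i W] vanish, which removes the convection and moment fluxes; what
   remains is [k i / 2] times a square, negative at the last layer and positive at the first. *)
have Gsum i : \sum_(al <- inner_seq J) (G W i al - G W i (al - ebas int i)) <= 0.
  apply: inner_telescope_le => al Jal ali.
    have al_face := inner_on_faceD Jal ali.
    rewrite /G (Wface i (al + _)) // (Dface i (al + _)) //.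
    rewrite !(mulr0, mul0r, subr0) expr0n sub0r mulrN oppr_le0.
    by rewrite mulr_ge0 ?sqr_ge0.
  have al_face := inner_on_faceB Jal ali.
  rewrite /G subrK (Wface i (al - _)) // (Dface i (al - _)) //.
  rewrite !(mulr0, mul0r, subr0) expr0n subr0.
  by rewrite mulr_ge0 ?sqr_ge0.
(* The terms [E] are nonnegative and by [Gsum] their sum is nonpositive, so each one is 0. *)
have Ezero al : inner J al -> E al = 0.
  have : \sum_(be <- inner_seq J | be \in inner_seq J) E be == 0.
    rewrite eq_le sumr_ge0 // andbT (eq_bigr _ EG) -big_seq exchange_big /=.
    exact: sumr_le0.
  rewrite psumr_eq0 // => /allP/(_ al) /[swap] Jal.
  by rewrite mem_inner_seq Jal => /(_ isT)/eqP.
have QcW al : inner J al -> (forall i, Q W i al = 0) /\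
    c (node a b J al) * W al ^+ 2 = 0.
  move=> Jal; have /eqP := Ezero _ Jal.
  rewrite paddr_eq0 ?sumr_ge0 ?cW0 //.
  rewrite psumr_eq0 // => /andP[/allP Qz /eqP cz]; split=> // i.
  by apply/eqP/Qz; rewrite mem_index_enum.
have QE al i : inner J al -> k i / 2 * ((W (al + ebas int i) - W al) ^+ 2
      + (W al - W (al - ebas int i)) ^+ 2) = 0 /\ m i * diff2 i W al ^+ 2 = 0.
  move=> /QcW[/(_ i)/eqP + _].
  rewrite paddr_eq0 //.
  by case/andP => /eqP ? /eqP.
(* One direction suffices when [eps] or [gamma] is positive; [0 < d] supplies it. *)
pose i0 := Ordinal d0.
case: hpos => [eps0|cpos|gamma0] al Jal.
- apply: (@inner_eq0_of_diff _ _ J i0) Jal => // [be|be Jbe]; first exact: Wface.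
  have [/eqP + _] := QE be i0 Jbe.
  rewrite mulf_eq0 gt_eqF /=; last first.
    by rewrite divr_gt0 // ltr_wpDl // divr_gt0 ?exprn_gt0.
  rewrite paddr_eq0 ?sqr_ge0 // => /andP[_].
  by rewrite sqrf_eq0 subr_eq0 => /eqP.
- have [_ /eqP] := QcW _ Jal.
  by rewrite mulf_eq0 gt_eqF ?cpos //= sqrf_eq0 => /eqP.
(* Now [m i0] is positive, so [diff2 i0 W] vanishes at inner indices and the sign condition holds
   with equality. *)
- apply: (@inner_eq0_of_diff2 _ _ J i0) Jal => // [be|be Jbe]; first exact: Wface.
  have [_ /eqP] := QE be i0 Jbe.
  rewrite mulf_eq0 gt_eqF /=; last first.
    by apply: divr_gt0; apply: mulr_gt0; rewrite ?powR_gt0 ?exprn_gt0 ?ltr0n.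
  by rewrite sqrf_eq0 => /eqP ->; rewrite mulr0.
Qed.

End Scheme.

(** * Ghost values by reflection *)

(* Odd reflection of [w] across the faces of the grid: it turns any grid
   function into one satisfying the second-difference boundary condition. *)
Definition ghost_ext (R : pzRingType) (d : nat) (J : 'I_d -> nat)
    (w : 'rV[int]_d -> R) (al : 'rV[int]_d) : R :=
  if [pick i | al 0 i == 0] is Some i
  then 2 * w (al + ebas int i) - w (al + ebas int i *+ 2)
  else if [pick i | al 0 i == (J i)%:Z + 1] is Some i
  then 2 * w (al - ebas int i) - w (al - ebas int i *+ 2)
  else w al.

Lemma ghost_ext_linear (R : comPzRingType) (d : nat) (J : 'I_d -> nat) (k : R)
    (u v : 'rV[int]_d -> R) :
  ghost_ext J (fun al => k * u al + v al) =
  (fun al => k * ghost_ext J u al + ghost_ext J v al).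
Proof.
apply/funext => al; rewrite /ghost_ext.
by case: pickP => [i _|_]; [|case: pickP => [i _|_]]; ring.
Qed.

Lemma ghost_ext_grid (R : pzRingType) (d : nat) (J : 'I_d -> nat)
    (w : 'rV[int]_d -> R) (al : 'rV[int]_d) :
  in_grid J al -> ghost_ext J w al = w al.
Proof.
move=> Jal; rewrite /ghost_ext; case: pickP => [i|_]; first by move: (Jal i); lia.
by case: pickP => [i|//]; move: (Jal i); lia.
Qed.

(** Inner, face and ghost values are in arithmetic progression by construction, once [pick] is seen
    to select [i]: the other coordinates of a face index are strictly inside, so none of them is 0
    or [J j + 1]. *)
Lemma diff2_ghost_ext (R : comPzRingType) (d : nat) (J : 'I_d -> nat)
    (i : 'I_d) (w : 'rV[int]_d -> R) (al : 'rV[int]_d) :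
  (3 <= J i)%N -> on_face J i al -> diff2 i (ghost_ext J w) al = 0.
Proof.
move=> Ji al_face; have [[ali|ali] alN] := al_face;
  rewrite /diff2 (ghost_ext_grid w (on_face_in_grid Ji al_face)).
- have -> : ghost_ext J w (al + ebas int i) = w (al + ebas int i).
    apply: ghost_ext_grid => j; rewrite !mxE eqxx /=.
    by case: (eqVneq j i) => [->|/alN] /=; lia.
  rewrite /ghost_ext; case: pickP => [j|/(_ i)]; last first.
    by rewrite !mxE !eqxx /=; lia.
  rewrite !mxE eqxx /=; case: (eqVneq j i) => [-> _|/alN /=]; last by lia.
  have -> : al - ebas int i + ebas int i *+ 2 = al + ebas int i.
    by rewrite mulr2n addrA subrK.
  by rewrite subrK; ring.
- have -> : ghost_ext J w (al - ebas int i) = w (al - ebas int i).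
    apply: ghost_ext_grid => j; rewrite !mxE eqxx /=.
    by case: (eqVneq j i) => [->|/alN] /=; lia.
  rewrite /ghost_ext; case: pickP => [j|_].
    by rewrite !mxE eqxx /=; case: (eqVneq j i) => [->|/alN] /=; lia.
  case: pickP => [j|/(_ i)]; last by rewrite !mxE !eqxx /=; lia.
  rewrite !mxE eqxx /=; case: (eqVneq j i) => [-> _|/alN /=]; last by lia.
  have -> : al + ebas int i - ebas int i *+ 2 = al - ebas int i.
    by rewrite mulr2n opprD addrA addrK.
  by rewrite addrK; ring.
Qed.

(** * Existence and uniqueness for the scheme *)

Theorem theorem6p2 (R : realType) (d : nat) (hd : (0 < d)%N)
    (a b : 'rV[R]_d) (hab : forall i, a 0 i < b 0 i)
    (bv : 'rV[R]_d) (c f g : 'rV[R]_d -> R) (c0 eps sigma gamma p : R)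
    (hcb : [bounded c x | x in box a b])
    (hc : forall x, box a b x -> 0 <= c x)
    (hc0 : c0 = inf [set c x | x in box a b])
    (hf : [bounded f x | x in box a b])
    (hg : {within boundary (box a b), continuous g})
    (heps : 0 <= eps) (hsigma : 0 <= sigma) (hgamma : 0 <= gamma)
    (hp : 0 <= p <= 1)
    (hpos : [\/ 0 < eps, 0 < c0 | 0 < gamma])
    (J : 'I_d -> nat) (hJ : forall i, (3 <= J i)%N) :
  exists U : 'rV[int]_d -> R,
    fd_solution a b J sigma eps gamma p bv c f g U /\
    forall V : 'rV[int]_d -> R,
      fd_solution a b J sigma eps gamma p bv c f g V -> grid_eq a b J V U.
Proof.
pose L := Lhat a b J sigma eps gamma p bv c.
have c_ge0 al : inner J al -> 0 <= c (node a b J al).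
  by move=> /(box_node hab hJ); exact: hc.
have hpos' : [\/ 0 < eps, forall al, inner J al -> 0 < c (node a b J al)
    | 0 < gamma].
  case: hpos => [?|c0_gt0|?]; [exact: Or31| |exact: Or33].
  apply: Or32 => al /(box_node hab hJ) al_box.
  apply: (lt_le_trans c0_gt0); rewrite hc0; apply: ge_inf.
    by exists 0 => _ [x /hc ? <-].
  by exists (node a b J al).
have L_inj W := @homogeneous_eq0 _ _ _ _ _ hab hJ _ _ _ p bv _ heps hsigma
  hgamma c_ge0 W hd hpos'.
have dxx_eq0 i W al : (dxx (step a b J) i W al = 0) <-> (diff2 i W al = 0).
  rewrite /dxx -/(diff2 i W al); split=> [/eqP|->]; last by rewrite mul0r.
  rewrite mulf_eq0 invr_eq0 expf_eq0 /=.
  by rewrite (negPf (lt0r_neq0 (step_gt0 hab hJ i))) orbF => /eqP.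
(* The unknowns are the inner values. [inn] sets all others to zero, while [P] below carries the
   boundary data, is zero inside and has reflected ghost values; the solution is sought as a
   reflected [inn u] plus [P]. *)
pose inn (u : 'rV[int]_d -> R) al := if inner J al then u al else 0.
have inn_lin k u v : inn (fun al => k * u al + v al) =
    (fun al => k * inn u al + inn v al).
  by apply/funext => al; rewrite /inn; case: ifP => _ //; ring.
pose P := ghost_ext J (fun al => if inner J al then 0 else g (node a b J al)).
have [|k u v al _|u Lu0 al|u uP] := @finite_system_solvable R _ (inner_seq J)
    (fun u => L (ghost_ext J (inn u))) _ _ _ (fun al => f (node a b J al) - L P al).
- exact: inner_seq_uniq.
- by rewrite inn_lin ghost_ext_linear /L Lhat_linear.
- rewrite mem_inner_seq => Jal.
  suff : ghost_ext J (inn u) al = 0.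
    by rewrite ghost_ext_grid; [rewrite /inn Jal|exact: inner_in_grid].
  (* The reflected cut-off meets the homogeneous boundary and ghost conditions, so the energy
     argument applies to it. *)
  apply: L_inj Jal => [be Jbe|be gbe Nbe|i be be_face].
  + by apply: Lu0; rewrite mem_inner_seq.
  + by rewrite ghost_ext_grid // /inn (negPf Nbe).
  + by apply/dxx_eq0/diff2_ghost_ext.
(* The factor 1 matches the shape [k * u + v] of the linearity lemmas, as does the factor -1 in [W]
   below. *)
pose U al := 1 * ghost_ext J (inn u) al + P al.
have U_ghost : U = ghost_ext J (fun al => 1 * inn u al +
    (if inner J al then 0 else g (node a b J al))).
  by rewrite ghost_ext_linear.
have U_sol : fd_solution a b J sigma eps gamma p bv c f g U.
  split=> [al /(interior_node hab hJ) Jal|al /(boundary_node hab hJ)[gal Nal]|i al].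
  - have := uP al; rewrite mem_inner_seq -/(L U al) => /(_ Jal) Lu.
    by rewrite /L Lhat_linear -/L mul1r Lu subrK.
  - by rewrite U_ghost ghost_ext_grid // /inn (negPf Nal) mulr0 add0r.
  - move=> /(Sbd_node hab hJ) al_face; apply/eqP; rewrite oppr_eq0; apply/eqP.
    by apply/dxx_eq0; rewrite U_ghost; exact: diff2_ghost_ext.
exists U; split=> // V V_sol.
have [UL Ubd Usb] := U_sol; have [VL Vbd Vsb] := V_sol.
have VU_inner al : inner J al -> V al = U al.
  move=> Jal; apply/eqP; rewrite -subr_eq0 addrC -mulN1r; apply/eqP.
  pose W be := -1 * U be + V be; rewrite -/(W al).
  apply: L_inj Jal => [be Jbe|be gbe Nbe|i be be_face].
  + have /(interior_node hab hJ) := Jbe; rewrite /W Lhat_linear => nbe.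
    by rewrite UL // VL // mulN1r addNr.
  + have /(boundary_node hab hJ) nbe : in_grid J be /\ ~~ inner J be by [].
    by rewrite /W Ubd // Vbd // mulN1r addNr.
  + have /(Sbd_node hab hJ) nbe := be_face; apply/dxx_eq0.
    move/eqP: (Usb _ _ nbe); rewrite oppr_eq0 => /eqP/dxx_eq0 U2.
    move/eqP: (Vsb _ _ nbe); rewrite oppr_eq0 => /eqP/dxx_eq0 V2.
    transitivity (-1 * diff2 i U be + diff2 i V be); last first.
      by rewrite U2 V2 mulr0 addr0.
    by rewrite /diff2 /W; ring.
have VU_grid al : in_grid J al -> V al = U al.
  move=> gal; have [/VU_inner//|Nal] := boolP (inner J al).
  have /(boundary_node hab hJ) nal : in_grid J al /\ ~~ inner J al by [].
  by rewrite Ubd // Vbd.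
move=> al [/(grid_node hab hJ)|]; first exact: VU_grid.
case=> al_out [i [x [xS]]].
have [be xE] : exists be, x = node a b J be.
  by case: xS => [[[be _ <-] _] _]; exists be.
rewrite {x}xE in xS *; rewrite -nodeDebas -nodeBebas => al_be.
(* A ghost point is not interior, so the interior neighbour of the face node [be] is the one
   opposite to it. The values at [be] and at that neighbour agree for [U] and [V], and the
   second-difference equation then fixes the ghost value. *)
have al_outer : ~~ inner J al.
  apply/negP => /(box_node hab hJ) nal; apply: al_out; exact: subset_closure.
have /(Sbd_node hab hJ) be_face := xS.
have VUbe : V be = U be by apply/VU_grid/(on_face_in_grid (hJ i)).
have U2 : diff2 i U be = 0.
  by apply/dxx_eq0/eqP; rewrite -oppr_eq0 Usb.
have V2 : diff2 i V be = 0.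
  by apply/dxx_eq0/eqP; rewrite -oppr_eq0 Vsb.
case: xS => _; rewrite -nodeDebas -nodeBebas !interior_node // => nb_inner.
move: V2; rewrite -U2 /diff2 VUbe.
case: al_be => /(node_inj hab hJ) al_be; rewrite al_be in al_outer *;
  case: nb_inner => Jn; rewrite ?Jn // in al_outer *.
- by rewrite (VU_inner _ Jn) => /addIr/addIr.
- by rewrite (VU_inner _ Jn) => /addrI.
Qed.
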